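(* Let $\mu$ be an $L$-subgroup of $G$ and let $\eta\in L(\mu)$ be such that $\eta(e)=\mu(e)$ and there exists exactly one $a_0\in L$ with $a_0\le\mu(e)$ such that $\eta_{a_0}$ is a maximal subgroup of $\mu_{a_0}$, while for all other $a\in L$ with $a\le\mu(e)$ one has $\eta_a=\mu_a$. Then $\eta$ is a maximal $L$-subgroup of $\mu$.
   Context: $L$ is a completely distributive (complete) lattice with least element $0$ and greatest element $1$; $G$ is a group with identity $e$. An $L$-subset of $G$ is a function $G\to L$; $\eta\subseteq\mu$ means $\eta(x)\le\mu(x)$ for all $x\in G$. For $a\in L$ the level subset is $\mu_a=\{x\in G:\mu(x)\ge a\}$. An $L$-subset $\mu$ of $G$ is an $L$-subgroup of $G$ if $\mu(xy)\ge\mu(x)\wedge\mu(y)$ and $\mu(x^{-1})=\mu(x)$ for all $x,y\in G$; its non-empty level subsets are subgroups of $G$. For an $L$-subgroup $\mu$ of $G$, $L(\mu)$ denotes the set of $L$-subgroups $\eta$ of $G$ with $\eta\subseteq\mu$ (called $L$-subgroups of $\mu$). An $\eta\in L(\mu)$ is proper if $\eta$ is non-constant and $\eta\neq\mu$. A proper $L$-subgroup $\eta$ of $\mu$ is a maximal $L$-subgroup of $\mu$ if whenever $\eta\subseteq\theta\subseteq\mu$ with $\theta\in L(\mu)$, then $\theta=\eta$ or $\theta=\mu$. *)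

(* Defs.v *)
From HB Require Import structures.
From mathcomp Require Import all_boot all_order.
From mathcomp Require Import boolp classical_sets.

Set Implicit Arguments.
Unset Strict Implicit.
Unset Printing Implicit Defensive.

Import Order.TTheory.

Local Open Scope classical_set_scope.
Local Open Scope order_scope.

Section CompletelyDistributive.
Context {d : Order.disp_t} (L : tbLatticeType d).

Definition complete_lattice : Prop :=
  forall A : set L, supremums A !=set0 /\ infimums A !=set0.

(* The default values of [supremum] and [infimum] are those taken on [set0]:
   with \bot and \top, these are the join and meet of a complete lattice. *)
Definition ljoin (A : set L) : L := supremum \bot A.
Definition lmeet (A : set L) : L := infimum \top A.

(* [f] ranges over the choice functions of the family [J]. *)
Definition completely_distributive : Prop :=
  complete_lattice /\
  forall (I : Type) (J : I -> set L),
    lmeet (range (fun i => ljoin (J i))) =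
    ljoin [set lmeet (range f) | f in [set f : I -> L | forall i, J i (f i)]].

End CompletelyDistributive.

Definition maximal_subgroup (G : groupType) (M H : set G) : Prop :=
  [/\ group_closed (mem M), group_closed (mem H), M `<=` H, M <> H &
      forall K : set G, group_closed (mem K) -> M `<=` K -> K `<=` H ->
        K = M \/ K = H].

Section LSubgroups.
Context {d : Order.disp_t} {L : tbLatticeType d} {G : groupType}.
Implicit Types (mu eta theta : G -> L) (a : L).

Definition Lsubset eta mu : Prop := forall x, eta x <= mu x.

Definition level mu a : set G := [set x | a <= mu x].

Definition Lsubgroup mu : Prop :=
  (forall x y, Order.meet (mu x) (mu y) <= mu (x * y)%g) /\
  (forall x, mu (x^-1)%g = mu x).

Definition Lsubgroup_of mu : set (G -> L) :=
  [set eta | Lsubgroup eta /\ Lsubset eta mu].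

Definition proper_Lsubgroup mu eta : Prop :=
  [/\ Lsubgroup_of mu eta, ~ (exists c, forall x, eta x = c) & eta <> mu].

Definition maximal_Lsubgroup mu eta : Prop :=
  proper_Lsubgroup mu eta /\
  forall theta, Lsubgroup_of mu theta ->
    Lsubset eta theta -> Lsubset theta mu -> theta = eta \/ theta = mu.

End LSubgroups.

(* Main.v *)
(* An L-subgroup below mu is determined by its level subsets at the a <= mu(e).
   Between eta and mu these are forced except at a0, where maximality of
   eta_a0 in mu_a0 leaves only two possibilities. *)
Require Import Defs.
From HB Require Import structures.
From mathcomp Require Import all_boot all_order.
From mathcomp Require Import boolp classical_sets.

Import Order.TTheory.

Local Open Scope order_scope.

Lemma Lsubgroup_le1 (d : Order.disp_t) (L : tbLatticeType d) (G : groupType)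
    (mu : G -> L) (x : G) : Lsubgroup mu -> mu x <= mu 1%g.
Proof.
by case=> muM muV; have := muM x (x^-1)%g; rewrite muV meetxx mulgV.
Qed.

(** The bound on [a] puts the identity into the level; closure under [x * y^-1] comes from the two
    axioms together. *)
Lemma level_group_closed (d : Order.disp_t) (L : tbLatticeType d)
    (G : groupType) (mu : G -> L) (a : L) :
  Lsubgroup mu -> a <= mu 1%g -> group_closed (mem (level mu a)).
Proof.
move=> [muM muV] a_le; split; first exact/mem_set.
move=> x y /set_mem ax /set_mem ay; apply/mem_set.
by apply: le_trans (muM _ _); rewrite lexI muV; apply/andP.
Qed.

Lemma Lsubset_level (d : Order.disp_t) (L : tbLatticeType d) (G : groupType)
    (mu nu : G -> L) (a : L) :
  Lsubset mu nu -> (level mu a `<=` level nu a)%classic.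
Proof. by move=> mu_nu x ax; apply: le_trans (mu_nu x). Qed.

(** Each [x] lies in the level of [mu] at its own value [mu x], so testing at [a = mu x] suffices,
    and [b] bounds all these values. *)
Lemma Lsubset_of_level (d : Order.disp_t) (L : tbLatticeType d)
    (G : groupType) (mu nu : G -> L) (b : L) :
  (forall x, mu x <= b) ->
  (forall a, a <= b -> (level mu a `<=` level nu a)%classic) -> Lsubset mu nu.
Proof. by move=> mu_le sub x; apply: (sub (mu x)) => //=; rewrite /level /=. Qed.

Lemma Lsubset_anti (d : Order.disp_t) (L : tbLatticeType d) (G : groupType)
    (mu nu : G -> L) : Lsubset mu nu -> Lsubset nu mu -> mu = nu.
Proof.
by move=> mu_nu nu_mu; apply/funext => x; apply/le_anti/andP.
Qed.

Theorem theorem3p8 (d : Order.disp_t) (L : tbLatticeType d)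
    (L_cd : completely_distributive L) (G : groupType)
    (mu eta : G -> L) (mu_Lsubgroup : Lsubgroup mu)
    (eta_in_mu : Lsubgroup_of mu eta)
    (eta_mu_e : eta 1%g = mu 1%g)
    (exactly_one :
      exists a0 : L,
        unique (fun a : L => a <= mu 1%g /\
                  maximal_subgroup (level eta a) (level mu a)) a0 /\
        (forall a : L, a <= mu 1%g -> a <> a0 -> level eta a = level mu a)) :
  maximal_Lsubgroup mu eta.
Proof.
have [a0 [[[a0_le [_ _ _ lev_neq lev_max]] _] lev_eq]] := exactly_one.
have [_ eta_mu] := eta_in_mu.
have eta_neq : eta <> mu by move=> eq_eta; apply: lev_neq; rewrite eq_eta.
split.
  (* A constant [eta] would take everywhere the value [mu 1], the largest value of [mu], and so
     would equal [mu]. *)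
  split=> // -[c eta_c]; apply: eta_neq; apply: Lsubset_anti => // x.
  by rewrite eta_c -(eta_c 1%g) eta_mu_e; apply: Lsubgroup_le1.
move=> theta [theta_sub _] eta_theta theta_mu.
have mu_le x : mu x <= mu 1%g by apply: Lsubgroup_le1.
have theta_le x : theta x <= mu 1%g by apply: le_trans (mu_le x).
(* Needed for the level of [theta] at [a0] to be a subgroup, so that maximality applies to it. *)
have a0_theta : a0 <= theta 1%g.
  by apply: le_trans (eta_theta _); rewrite eta_mu_e.
have [theta_a0|theta_a0] := lev_max _ (level_group_closed _ _ _ _ _ theta_sub a0_theta)
  (Lsubset_level _ _ _ _ _ _ eta_theta) (Lsubset_level _ _ _ _ _ _ theta_mu).
(* Away from [a0], the level of [theta] lies in that of [mu], which is that of [eta]. *)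
- left; apply: Lsubset_anti => //; apply: Lsubset_of_level theta_le _ => a a_le.
  have [->|/eqP a_neq] := eqVneq a a0; first by rewrite theta_a0.
  by rewrite lev_eq //; apply: Lsubset_level.
(* Dually, away from [a0] the level of [mu] is that of [eta], which lies in that of [theta]. *)
- right; apply: Lsubset_anti => //; apply: Lsubset_of_level mu_le _ => a a_le.
  have [->|/eqP a_neq] := eqVneq a a0; first by rewrite theta_a0.
  by rewrite -lev_eq //; apply: Lsubset_level.
Qed.
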